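(* Let $\Omega=\{1,\dots,r\}^{\mathbb{N}}$, let $\theta\in(0,1)$, and let $\log J:\Omega\to\mathbb{R}$ be a function which is Lipschitz for the metric $d_\theta$ and normalized, i.e. $\mathcal{L}_{\log J}(1)=1$. Let $C,\alpha_1,\delta,a$ and the metric $D$ on $\Omega$ be as fixed in the context, and let $d_1$ be the $1$-Wasserstein distance associated to $D$. Set $\alpha=\max\{1-\frac a2,\ \frac12(1+\alpha_1)\}<1$. Then there exists an integer $t>0$ such that for all Borel probabilities $\mu_1,\mu_2$ on $\Omega$, $$d_1\big((\mathcal{L}_{\log J}^{*})^t(\mu_1),(\mathcal{L}_{\log J}^{*})^t(\mu_2)\big)\le\alpha\,d_1(\mu_1,\mu_2).$$
   Context: Points of $\Omega$ are $x=(x_1,x_2,\dots)$. The metric $d_\theta$ is $d_\theta(x,y)=\theta^N$ where $x_1=y_1,\dots,x_{N-1}=y_{N-1}$, $x_N\ne y_N$ (and $d_\theta(x,x)=0$). The Ruelle operator is $\mathcal{L}_{\log J}(\psi)(x)=\sum_{b=1}^r J(bx)\psi(bx)$, with $bx=(b,x_1,x_2,\dots)$. Its dual $\mathcal{L}_{\log J}^*$ acts on Borel probabilities by $\int\psi\,d\mathcal{L}_{\log J}^*(\mu)=\int\mathcal{L}_{\log J}(\psi)\,d\mu$ for all continuous $\psi$. $\mathcal{C}(\mu_1,\mu_2)$ is the set of Borel probabilities on $\Omega\times\Omega$ with first marginal $\mu_1$ and second marginal $\mu_2$. For $f:\Omega\to\mathbb{R}$ let $\mathrm{var}_nf=\sup\{|f(x)-f(y)|: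 x,y \text{ agree in their first } n \text{ coordinates}\}$ and $|f|_\theta=\sup_{n\ge0}\mathrm{var}_nf/\theta^n$. Constants: $C>0$ and $\alpha_1\in(0,1)$ are such that the Lasota–Yorke inequality $|\mathcal{L}_{\log J}^t\phi|_\theta\le C\sup_x|\phi(x)|+\alpha_1|\phi|_\theta$ holds for every integer $t\ge1$ and every Lipschitz $\phi$ (such constants exist). $\delta$ is a fixed number with $0<\delta<\frac{1-\alpha_1}{2C}$. $a>0$ is a constant for which there is $T$ such that for all $k\ge T$ and all $x,y\in\Omega$, $$\sup_{\Gamma\in\mathcal{C}((\mathcal{L}_{\log J}^* )^k\delta_x,(\mathcal{L}_{\log J}^* )^k\delta_y)}\Gamma\{(x',y'):d_\theta(x',y')\le\tfrac\delta2\}\ge a$$ (such $a$ exists; $\delta_x$ is the Dirac mass at $x$). The metric is $D(x,y)=\min\{1,\delta^{-1}d_\theta(x,y)\}$ and $$d_1(\mu_1,\mu_2)=\inf_{\Gamma\in\mathcal{C}(\mu_1,\mu_2)}\int D(x,y)\,\Gamma(dx,dy).$$ *)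

(* Defs.v *)
From HB Require Import structures.
From mathcomp Require Import all_boot all_order all_algebra.
From mathcomp Require Import all_classical all_reals all_analysis.
Import Order.TTheory GRing.Theory Num.Theory numFieldNormedType.Exports.

Set Implicit Arguments.
Unset Strict Implicit.
Unset Printing Implicit Defensive.

Local Open Scope classical_set_scope.
Local Open Scope ring_scope.

HB.instance Definition _ (r : nat) := isPointed.Build 'I_r.+1 ord0.

(* The alphabet has r.+1 letters, so that it is never empty and [Omega r] is
   pointed, as measurableType requires.  Coordinates are indexed from 0. *)
Definition Omega (r : nat) : Type :=
  prod_topology (fun _ : nat => discrete_topology 'I_r.+1).

HB.instance Definition _ r := Pointed.on (Omega r).
HB.instance Definition _ r := Nbhs.on (Omega r).
HB.instance Definition _ r := Topological.on (Omega r).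

(* Borel sigma-algebra.  [Omega r] is second countable, so the product
   sigma-algebra on [Omega r * Omega r] is again the Borel one. *)
HB.instance Definition _ r :=
  Measurable.copy (Omega r) (g_sigma_algebraType (@open (Omega r))).

Definition prepend (r : nat) (b : 'I_r.+1) (x : Omega r) : Omega r :=
  fun n => if n is m.+1 then x m else b.

(* If the first disagreement is at 0-based position n, it is at position
   N = n.+1 when coordinates are counted from 1. *)
Definition dtheta (R : realType) (r : nat) (theta : R) (x y : Omega r) : R :=
  if pselect (exists n : nat, x n != y n) is left xy
  then theta ^+ (ex_minn xy).+1 else 0.

Definition dtheta_lipschitz (R : realType) (r : nat) (theta : R)
    (f : Omega r -> R) : Prop :=
  exists K : R, forall x y, `|f x - f y| <= K * dtheta theta x y.

Definition variation (R : realType) (r : nat) (f : Omega r -> R) (n : nat) :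
    \bar R :=
  ereal_sup [set (`|f xy.1 - f xy.2|)%:E | xy in
    [set xy : Omega r * Omega r | forall i, (i < n)%N -> xy.1 i = xy.2 i]].

Definition theta_seminorm (R : realType) (r : nat) (theta : R)
    (f : Omega r -> R) : \bar R :=
  ereal_sup (range (fun n : nat =>
    (variation f n * ((theta ^+ n)^-1)%:E)%E)).

Definition sup_abs (R : realType) (r : nat) (f : Omega r -> R) : \bar R :=
  ereal_sup (range (fun x => (`|f x|)%:E)).

(* The Ruelle operator of the potential logJ, so that J = exp logJ. *)
Definition ruelle (R : realType) (r : nat) (logJ psi : Omega r -> R) :
    Omega r -> R :=
  fun x => \sum_(b < r.+1) expR (logJ (prepend b x)) * psi (prepend b x).

(* For logJ continuous and normalized there is exactly one probability with
   the required property (Riesz representation); the default value mu is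
   never used in that case. *)
Definition ruelle_dual (R : realType) (r : nat) (logJ : Omega r -> R)
    (mu : probability (Omega r) R) : probability (Omega r) R :=
  xget mu [set nu : probability (Omega r) R |
    forall psi : Omega r -> R, continuous psi ->
      (\int[nu]_x (psi x)%:E = \int[mu]_x (ruelle logJ psi x)%:E)%E].

Definition couplings (R : realType) (r : nat)
    (mu1 mu2 : probability (Omega r) R) :
    set (probability (Omega r * Omega r)%type R) :=
  [set G : probability (Omega r * Omega r)%type R |
    forall A : set (Omega r), measurable A ->
      pushforward G fst A = mu1 A /\ pushforward G snd A = mu2 A].

Definition Dmetric (R : realType) (r : nat) (theta delta : R)
    (x y : Omega r) : R :=
  Num.min 1 (delta^-1 * dtheta theta x y).

Definition wasserstein1 (R : realType) (r : nat) (D : Omega r -> Omega r -> R)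
    (mu1 mu2 : probability (Omega r) R) : \bar R :=
  ereal_inf [set (\int[G]_p (D p.1 p.2)%:E)%E | G in couplings mu1 mu2].

Definition dirac_prob (R : realType) (r : nat) (x : Omega r) :
  probability (Omega r) R := @dirac _ (Omega r) x R.

(* Main.v *)
Require Import Defs.
From HB Require Import structures.
From mathcomp Require Import all_boot all_order all_algebra.
From mathcomp Require Import all_classical all_reals all_analysis.
From mathcomp Require Import measurable_realfun giry lra.
Import Order.TTheory GRing.Theory Num.Theory numFieldNormedType.Exports.
Local Open Scope classical_set_scope.
Local Open Scope ring_scope.

Set Implicit Arguments.
Unset Strict Implicit.
Unset Printing Implicit Defensive.

(* A coupling of [mu1] and [mu2] is pushed to a coupling of the images under
   the dual operator by prepending to a pair [(x, y)] a pair of letters drawn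
   from the maximal coupling of [J (. x)] and [J (. y)].  If [x] and [y] first
   disagree at position [n], then with probability at least
   [exp (- K theta^n)] the same letter is prepended, and the disagreement moves
   to position [n + 1]; otherwise it falls back to some lower position.  A cost
   [V n] comparable to [theta^n] is multiplied by at most some [rho < 1] in
   expectation at each step, so that [D], which is comparable to it, is
   contracted by [1/2 <= alpha] after enough steps. *)

(** * Topology and Borel sets of the shift space *)

Definition agree (r n : nat) (x y : Omega r) := forall i, (i < n)%N -> x i = y i.

Lemma agreeS (r m n : nat) (x y : Omega r) :
  (m <= n)%N -> agree n x y -> agree m x y.
Proof. by move=> mn xy i im; apply: xy; exact: leq_trans mn. Qed.

Lemma coord_continuous (r i : nat) :
  continuous (fun x : Omega r => x i : discrete_topology 'I_r.+1).
Proof. exact: (@proj_continuous nat (fun=> discrete_topology 'I_r.+1) i). Qed.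

Lemma nbhs_agree (r n : nat) (x : Omega r) : nbhs x [set y | agree n x y].
Proof.
elim: n => [|n IHn].
  by rewrite (_ : [set _ | _] = setT); [exact: filterT|rewrite -subTset].
have xn : nbhs x [set y : Omega r | y n = x n].
  exact: (@coord_continuous r n x [set x n] (discrete_set1 _)).
apply: filterS (filterI IHn xn) => y [/= xy yn] i.
by rewrite ltnS leq_eqVlt => /predU1P[->//|/xy].
Qed.

(** The product topology is the supremum of the topologies induced by the coordinates. The filter of
    cylinders around [x] converges to [x] in each of them, because agreement up to [i.+1] fixes
    coordinate [i], hence also in the supremum. *)
Lemma nbhs_Omega (r : nat) (x : Omega r) (U : set (Omega r)) :
  nbhs x U <-> exists n, [set y | agree n x y] `<=` U.
Proof.
split=> [xU|[n nU]]; last exact: filterS nU (@nbhs_agree r n x).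
pose F := filter_from [set: nat] (fun n => [set y : Omega r | agree n x y]).
have FF : Filter F.
  apply: filter_from_filter; first by exists 0%N.
  move=> i j _ _; exists (maxn i j) => // y xy; split; apply: agreeS xy.
    exact: leq_maxl.
  exact: leq_maxr.
suff /(_ U xU)[n _ nU] : F --> x by exists n.
apply/cvg_sup => i.
move=> V [W [oW Wx] WV].
case: oW => W' oW' W'W.
exists i.+1 => // y /(_ i (ltnSn i)) xy; apply: WV.
by rewrite -W'W /= -xy; rewrite -W'W in Wx.
Qed.

Lemma open_Omega (r : nat) (U : set (Omega r)) :
  open U <-> forall x, U x -> exists n, [set y | agree n x y] `<=` U.
Proof.
rewrite openE; split=> [oU x /oU|oU x /oU xU]; first by move/nbhs_Omega.
by apply/nbhs_Omega.
Qed.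

Lemma continuous_Omega (R : realType) (r : nat) (f : Omega r -> R) :
  continuous f <->
  forall x (e : R), 0 < e -> exists n, forall y, agree n x y -> `|f x - f y| < e.
Proof.
split=> [cf x e e0|cf x].
  have /cvgrPdist_lt/(_ e e0) := cf x.
  by move/nbhs_Omega => [n nU]; exists n => y /nU.
move=> U /nbhs_ballP[e /= e0 eU]; have [n ne] := cf x e e0.
by apply/nbhs_Omega; exists n => y /ne fxy; exact: eU.
Qed.

Lemma open_measurable_Omega (r : nat) (U : set (Omega r)) :
  open U -> measurable U.
Proof. exact: sub_sigma_algebra. Qed.

Lemma continuous_measurable_Omega (R : realType) (r : nat) (f : Omega r -> R) :
  continuous f -> measurable_fun setT f.
Proof.
move=> /continuousP cf.
apply: (measurability _ (measurable_realfun.RGenOpens.measurableE R)).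
move=> _ [_ [a [b ->]] <-]; rewrite setTI.
by apply: open_measurable_Omega; apply: cf; exact: interval_open.
Qed.

Lemma prepend_continuous (r : nat) (b : 'I_r.+1) : continuous (prepend b).
Proof.
move=> x U /nbhs_Omega[n nU]; apply/nbhs_Omega; exists n => y xy.
by apply: nU => -[|i] //= lt_in; apply: xy; exact: ltnW.
Qed.

Lemma measurable_prepend (r : nat) (b : 'I_r.+1) :
  measurable_fun setT (prepend b).
Proof.
apply: (@measurability _ _ _ (Omega r) setT _ (@open (Omega r))) => //.
move=> _ [U oU <-]; rewrite setTI.
apply: open_measurable_Omega.
by move/continuousP: (@prepend_continuous r b); exact.
Qed.

Lemma measurable_coord (r i : nat) (b : 'I_r.+1) :
  measurable [set x : Omega r | x i = b].
Proof.
apply: open_measurable_Omega; apply/open_Omega => x /= <-; exists i.+1 => y.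
by move/(_ i (ltnSn i)).
Qed.

Lemma compact_Omega (r : nat) : compact [set: Omega r].
Proof.
have cT (i : nat) : compact [set: discrete_topology 'I_r.+1].
  by apply: finite_compact; exact: (@finite_finset 'I_r.+1 setT).
have := @tychonoff nat (fun=> discrete_topology 'I_r.+1) (fun=> setT) cT.
by rewrite (_ : [set _ | _] = setT)//; apply/seteqP; split.
Qed.

Lemma continuous_bounded_Omega (R : realType) (r : nat) (f : Omega r -> R) :
  continuous f -> exists M, forall x, `|f x| <= M.
Proof.
move=> cf.
have /compact_bounded[M [_ fM]] : compact (f @` setT).
  apply: continuous_compact; last exact: compact_Omega.
  exact: continuous_subspaceT.
exists (M + 1) => x; apply: (fM (M + 1)); first by rewrite ltrDl.
by exists x.
Qed.

(** * Random choice of a map *)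

Section mixture.
Context d1 d2 (T1 : measurableType d1) (T2 : measurableType d2) (R : realType).
Variables (n : nat) (f : nat -> T1 -> T2) (w : nat -> T1 -> R).
Hypothesis mf : forall k, measurable_fun setT (f k).
Hypothesis mw : forall k, measurable_fun setT (w k).
Hypothesis w_ge0 : forall k x, 0 <= w k x.
Hypothesis w_sum1 : forall x, \sum_(k < n) w k x = 1.

(* The absolute value only serves to infer nonnegativity. *)
Let fiber (x : T1) : set T2 -> \bar R :=
  msum (fun k => mscale (`|w k x|%:nng) (\d_(f k x))) n.

Let fiberE x A : fiber x A = (\sum_(k < n) (w k x)%:E * \d_(f k x) A)%E.
Proof. apply: eq_bigr => k _.
by rewrite -[X in (X%:E * _)%E](ger0_norm (w_ge0 k x)).
Qed.

Let fiber_setT x : (fiber x setT = 1)%E.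
Proof.
rewrite fiberE (eq_bigr (fun k : 'I_n => (w k x)%:E)) ?sumEFin ?w_sum1//.
by move=> k _; rewrite diracT mule1.
Qed.

HB.instance Definition _ x := Measure.on (fiber x).
HB.instance Definition _ x := @Measure_isProbability.Build _ _ _ (fiber x)
  (fiber_setT x).

Let kappa (x : T1) : giry T2 R := fiber x.

Let measurable_kappa : measurable_fun setT kappa.
Proof.
apply: measurable_giry_codensity => // B mB; rewrite /giry_ev /kappa/=.
under eq_fun do rewrite fiberE.
apply: emeasurable_sum => k.
apply: emeasurable_funM; first exact/measurable_EFinP.
have h := measurableT_comp (@measurable_fun_dirac _ T2 R setT B mB) (mf k).
exact: h.
Qed.

Variable mu : probability T1 R.

Let mixture : set T2 -> \bar R := giry_bind (mu : giry T1 R) measurable_kappa.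

Let integral_fiber x (h : T2 -> \bar R) : measurable_fun setT h ->
  (forall y, 0 <= h y)%E ->
  (\int[fiber x]_y h y = \sum_(k < n) (w k x)%:E * h (f k x))%E.
Proof.
move=> mh h0; rewrite ge0_integral_measure_sum//; apply: eq_bigr => k _.
rewrite ge0_integral_mscale// integral_dirac// diracT mul1e.
by rewrite -[in RHS](ger0_norm (w_ge0 k x)).
Qed.

Let integral_mixture (h : T2 -> \bar R) : measurable_fun setT h ->
  (forall y, 0 <= h y)%E ->
  (\int[giry_bind (mu : giry T1 R) measurable_kappa]_y h y =
   \int[mu]_x \sum_(k < n) (w k x)%:E * h (f k x))%E.
Proof.
move=> mh h0; have := giry_int_bind (mu : giry T1 R) measurable_kappa mh h0.
rewrite /giry_int => ->; apply: eq_integral => x _.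
exact: integral_fiber.
Qed.

Let mixture_setT : (mixture setT = 1)%E.
Proof.
transitivity (\int[giry_bind (mu : giry T1 R) measurable_kappa]_y 1)%E.
  by rewrite integral_cst// mul1e.
rewrite integral_mixture//; under eq_integral => x _.
  under eq_bigr do rewrite mule1.
  rewrite sumEFin w_sum1.
  over.
by rewrite integral_cst// mul1e; exact: (probability_setT mu).
Qed.

HB.instance Definition _ := Measure.on mixture.
HB.instance Definition _ := @Measure_isProbability.Build _ _ _ mixture
  mixture_setT.

(** [nu] is the law of [f k x] when [x] is drawn from [mu] and then [k] with probability [w k x]:
    the Giry bind of [mu] with the kernel [kappa]. *)
Lemma exists_mixture_nat : exists nu : probability T2 R,
  forall h : T2 -> \bar R, measurable_fun setT h -> (forall y, 0 <= h y)%E ->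
  (\int[nu]_y h y = \int[mu]_x \sum_(k < n) (w k x)%:E * h (f k x))%E.
Proof. by exists mixture => h mh h0; exact: integral_mixture. Qed.

End mixture.

Lemma exists_mixture d1 d2 (T1 : measurableType d1) (T2 : measurableType d2)
    (R : realType) (I : finType) (f : I -> T1 -> T2) (w : I -> T1 -> R)
    (mu : probability T1 R) :
  (forall i, measurable_fun setT (f i)) ->
  (forall i, measurable_fun setT (w i)) ->
  (forall i x, 0 <= w i x) -> (forall x, \sum_i w i x = 1) ->
  exists nu : probability T2 R, forall h : T2 -> \bar R,
    measurable_fun setT h -> (forall y, 0 <= h y)%E ->
    (\int[nu]_y h y = \int[mu]_x \sum_i (w i x)%:E * h (f i x))%E.
Proof.
(* With [I] empty the weights at [point] would sum to 0. Otherwise [i0] serves as the default of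
   [nth] in an enumeration of [I]. *)
move=> mf mw w0 w1; have [i0 _|I0] := pickP (@predT I); last first.
  have := w1 point; rewrite big1; first by move/esym/eqP; rewrite oner_eq0.
  by move=> i _; have := I0 i.
have sumI (V : nmodType) (F : I -> V) :
    \sum_(k < size (enum I)) F (nth i0 (enum I) k) = \sum_i F i.
  by rewrite -[RHS]big_enum (big_nth i0) big_mkord.
have [nu nuE] := exists_mixture_nat (fun k => mf (nth i0 (enum I) k))
  (fun k => mw (nth i0 (enum I) k)) (fun k => w0 (nth i0 (enum I) k))
  (fun x => etrans (sumI _ (w^~ x)) (w1 x)) mu.
exists nu => h mh h0; rewrite nuE//; apply: eq_integral => x _.
exact: (sumI _ (fun i => (w i x)%:E * h (f i x))%E).
Qed.

(** * The dual of the Ruelle operator *)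

(** The open sets form a generating family closed under intersection. An open [U] is the increasing
    union of the sets [F n] of points whose cylinder of length [n] lies in [U], and the indicator of
    [F n] is continuous since it depends on [n] coordinates only. *)
Lemma probability_Omega_eq (R : realType) (r : nat)
    (mu nu : probability (Omega r) R) :
  (forall psi : Omega r -> R, continuous psi ->
    (\int[mu]_x (psi x)%:E = \int[nu]_x (psi x)%:E)%E) ->
  forall A, measurable A -> mu A = nu A.
Proof.
move=> munu A mA.
apply: (@measure_unique _ R (Omega r) (@open (Omega r)) (fun=> setT)) => //.
- exact: openI.
- by move=> _; exact: openT.
- by rewrite bigcup_const.
- move=> U oU.
  pose F n := [set x : Omega r | forall y, agree n x y -> U y].
  have FE n x y : agree n x y -> F n x -> F n y.
    move=> xy Fx z yz; apply: Fx => i lt_in.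
    by rewrite xy//; exact: yz.
  have oF n : open (F n) by apply/open_Omega => x Fx; exists n => y /FE; exact.
  have mF n : measurable (F n) by exact: open_measurable_Omega.
  have UF : \bigcup_n F n = U.
    apply/seteqP; split=> [x [n _]|x Ux]; first by apply.
    by have /open_Omega/(_ x Ux)[n nU] := oU; exists n => // y /nU.
  have ndF : nondecreasing_seq F.
    move=> m n mn; apply/subsetPset => x Fx y xy.
    by apply: Fx; exact: agreeS xy.
  have munuF n : mu (F n) = nu (F n).
    rewrite -[F n]setIT -!integral_indic//; apply: munu.
    apply/continuous_Omega => x e e0; exists n => y xy.
    rewrite (_ : \1_(F n) y = \1_(F n) x) ?subrr ?normr0//.
    rewrite !indicE; congr (_%:R); congr nat_of_bool; apply/idP/idP; rewrite !inE.
      by apply: FE => i lt_in; rewrite xy.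
    exact: FE.
  have cvgF (P : probability (Omega r) R) : P (F n) @[n --> \oo] --> P U.
    rewrite -UF; apply: nondecreasing_cvg_mu => //.
    exact: bigcup_measurable.
  have := cvgF mu; under eq_fun do rewrite munuF.
  move=> /(cvg_lim (@ereal_hausdorff R)) muU; apply: etrans (esym muU) _.
  have /(cvg_lim (@ereal_hausdorff R)) := cvgF nu; exact.
- move=> k; rewrite (_ : _ setT = 1%E) ?ltry//.
  exact: probability_setT mu.
Qed.

(** The mixture formula concerns nonnegative functions; a shift by a bound carries it over to
    bounded functions of any sign. *)
Lemma integralDcst (d : measure_display) (T : measurableType d) (R : realType)
    (mu : probability T R) (g : T -> R) (M : R) :
  measurable_fun setT g -> (forall x, `|g x| <= M) ->
  (\int[mu]_x (g x)%:E = \int[mu]_x (g x + M)%:E - M%:E)%E.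
Proof.
move=> mg gM.
have muT : (mu setT < +oo)%E by rewrite probability_setT ltry.
have ig : mu.-integrable setT (EFin \o g).
  apply: measurable_bounded_integrable => //.
  exists M; split=> [|x Mx y _]; first exact: num_real.
  exact: le_trans (gM y) (ltW Mx).
have iM : mu.-integrable setT (EFin \o cst M).
  exact: finite_measure_integrable_cst.
have intM : (\int[mu]_x (cst M x)%:E = M%:E)%E.
  apply: (etrans (integral_cst mu measurableT M%:E)).
  by rewrite -[RHS]mule1; congr (_ * _)%E; exact: probability_setT.
under [in RHS]eq_integral do rewrite EFinD.
by rewrite integralD// intM addeK.
Qed.

Section ruelle_dual.
Context (R : realType) (r : nat) (logJ : Omega r -> R).
Hypothesis cJ : continuous logJ.
Hypothesis J1 : forall x, ruelle logJ (fun=> 1) x = 1.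

Lemma measurable_weight b :
  measurable_fun setT (fun x => expR (logJ (prepend b x))).
Proof.
apply: measurableT_comp; first exact: measurable_expR.
apply: measurableT_comp; last exact: measurable_prepend.
exact: continuous_measurable_Omega.
Qed.

Lemma sum_weight x : \sum_b expR (logJ (prepend b x)) = 1.
Proof. by rewrite -(J1 x); apply: eq_bigr => b _; rewrite mulr1. Qed.

(** The mixture of the maps [prepend b] with weights [expR (logJ (prepend b x))] has the property
    defining the dual, and continuous functions determine a probability, so the dual is this
    mixture. The duality thereby extends to nonnegative measurable [h]. *)
Lemma integral_ruelle_dual (mu : probability (Omega r) R) (h : Omega r -> \bar R) :
  measurable_fun setT h -> (forall x, 0 <= h x)%E ->
  (\int[ruelle_dual logJ mu]_x h x =
   \int[mu]_x \sum_b (expR (logJ (prepend b x)))%:E * h (prepend b x))%E.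
Proof.
move=> mh h0.
have [nu nuE] := exists_mixture mu (@measurable_prepend r) measurable_weight
  (fun b x => expR_ge0 _) sum_weight.
rewrite -nuE//; apply: eq_measure_integral => A mA _.
apply: probability_Omega_eq => // psi cpsi.
suff nuP : [set nu : probability (Omega r) R |
    forall psi : Omega r -> R, continuous psi ->
      (\int[nu]_x (psi x)%:E = \int[mu]_x (ruelle logJ psi x)%:E)%E] nu.
  (* Since [nu] inhabits the set, [xget] returns one of its elements and not the default [mu]. *)
  by rewrite nuP//; have := xgetPex mu (ex_intro _ nu nuP); exact.
move=> {cpsi}psi cpsi /=.
have mpsi := continuous_measurable_Omega cpsi.
have [M psiM] := continuous_bounded_Omega cpsi.
rewrite (integralDcst nu mpsi psiM) nuE; last 2 first.
- by apply/measurable_EFinP; exact: measurable_funD.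
- move=> x; rewrite lee_fin -lerBlDr sub0r.
  by have := psiM x; rewrite ler_norml => /andP[].
(* The same [M] bounds [ruelle logJ psi], a weighted average of values of [psi], so the two shifts
   cancel. *)
rewrite (@integralDcst _ _ _ mu _ M); last 2 first.
- apply: measurable_sum => b; apply: measurable_funM; first exact: measurable_weight.
  by apply: measurableT_comp => //; exact: measurable_prepend.
- move=> x; apply: le_trans (ler_norm_sum _ _ _) _.
  rewrite -[leRHS]mul1r -(sum_weight x) mulr_suml; apply: ler_sum => b _.
  by rewrite normrM gtr0_norm ?expR_gt0// ler_pM2l// expR_gt0.
congr (_ - _)%E; apply: eq_integral => x _.
rewrite -[in RHS](mul1r M) -[in RHS](sum_weight x) mulr_suml -big_split/=.
rewrite -sumEFin; apply: eq_bigr => b _.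
by rewrite -EFinM mulrDr.
Qed.

End ruelle_dual.

(** * Couplings *)

Section maximal_coupling.
Context (R : realFieldType) (I : finType) (p q : I -> R).

(** For probability vectors this is one minus the total variation distance. *)
Definition overlap : R := \sum_b Num.min (p b) (q b).

(* Division by [1 - overlap = 0] yields [0]: in that case [p = q]. *)
Definition max_coupling (bc : I * I) : R :=
  (if bc.1 == bc.2 then Num.min (p bc.1) (q bc.1) else 0) +
  (p bc.1 - Num.min (p bc.1) (q bc.1)) * (q bc.2 - Num.min (p bc.2) (q bc.2)) /
  (1 - overlap).

Hypotheses (p_ge0 : forall b, 0 <= p b) (q_ge0 : forall b, 0 <= q b).
Hypotheses (p_sum1 : \sum_b p b = 1) (q_sum1 : \sum_b q b = 1).

Lemma overlap_le1 : overlap <= 1.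
Proof. by rewrite -p_sum1; apply: ler_sum => b _; rewrite ge_min lexx. Qed.

Lemma sum_excessl : \sum_b (p b - Num.min (p b) (q b)) = 1 - overlap.
Proof. by rewrite sumrB p_sum1. Qed.

Lemma sum_excessr : \sum_b (q b - Num.min (p b) (q b)) = 1 - overlap.
Proof. by rewrite sumrB q_sum1. Qed.

Lemma max_coupling_ge0 bc : 0 <= max_coupling bc.
Proof.
rewrite addr_ge0//; first by case: ifP => // _; rewrite le_min p_ge0 q_ge0.
rewrite mulr_ge0// ?invr_ge0 ?subr_ge0 ?overlap_le1// mulr_ge0// subr_ge0.
  by rewrite ge_min lexx.
by rewrite ge_min lexx orbT.
Qed.

Lemma max_coupling_suml b : \sum_c max_coupling (b, c) = p b.
Proof.
rewrite big_split/= -big_mkcond/= (big_pred1 b) => [|c]; last exact: eq_sym.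
rewrite -mulr_suml -mulr_sumr sum_excessr.
(* If the overlap is 1, the excesses of [p] over the minimum are nonnegative with sum 0, so each
   vanishes and the diagonal part alone has marginal [p]. *)
have [s1|s1] := eqVneq (1 - overlap) 0; last by rewrite mulfK// addrC subrK.
rewrite s1 mulr0 mul0r addr0; apply/esym/eqP; rewrite -subr_eq0; apply/eqP.
have := sum_excessl; rewrite s1 => /psumr_eq0P -> // i _.
by rewrite subr_ge0 ge_min lexx.
Qed.

Lemma max_coupling_sumr c : \sum_b max_coupling (b, c) = q c.
Proof.
rewrite big_split/= -big_mkcond/= (big_pred1 c)//=.
rewrite -mulr_suml -mulr_suml sum_excessl.
have [s1|s1] := eqVneq (1 - overlap) 0.
  rewrite s1 mul0r mul0r addr0; apply/esym/eqP; rewrite -subr_eq0; apply/eqP.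
  have := sum_excessr; rewrite s1 => /psumr_eq0P -> // i _.
  by rewrite subr_ge0 ge_min lexx orbT.
by rewrite mulrAC mulfV// mul1r addrC subrK.
Qed.

Lemma max_coupling_sum1 : \sum_bc max_coupling bc = 1.
Proof.
rewrite -p_sum1 -(eq_bigr _ (fun b _ => max_coupling_suml b)).
by rewrite pair_bigA/=; apply: eq_bigr => -[].
Qed.

(** The diagonal part is integrated exactly; the remaining product part has total mass
    [1 - overlap], and there [g] is bounded by 1. *)
Lemma max_coupling_cost (g : I * I -> R) : (forall bc, g bc <= 1) ->
  \sum_bc max_coupling bc * g bc <=
  \sum_b Num.min (p b) (q b) * g (b, b) + (1 - overlap).
Proof.
move=> g1.
have -> : 1 - overlap = \sum_(bc : I * I) (p bc.1 - Num.min (p bc.1) (q bc.1)) *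
    (q bc.2 - Num.min (p bc.2) (q bc.2)) / (1 - overlap).
  rewrite -mulr_suml -(pair_bigA _ (fun b c =>
    (p b - Num.min (p b) (q b)) * (q c - Num.min (p c) (q c))))/=.
  under eq_bigr do rewrite -mulr_sumr.
  rewrite -mulr_suml sum_excessl sum_excessr.
  by have [->|s1] := eqVneq (1 - overlap) 0; rewrite ?mul0r// mulfK.
have -> : \sum_b Num.min (p b) (q b) * g (b, b) =
    \sum_(bc : I * I)
      (if bc.1 == bc.2 then Num.min (p bc.1) (q bc.1) else 0) *
      g (bc.1, bc.2).
  rewrite -(pair_bigA _ (fun b c =>
    (if b == c then Num.min (p b) (q b) else 0) * g (b, c)))/=.
  apply: eq_bigr => b _; rewrite (bigD1 b)//= eqxx big1 ?addr0// => c.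
    by rewrite eq_sym => /negbTE ->; rewrite mul0r.
rewrite -big_split/=; apply: ler_sum => -[b c] _ /=.
rewrite mulrDl lerD2l ler_piMr//.
rewrite mulr_ge0// ?invr_ge0 ?subr_ge0 ?overlap_le1// mulr_ge0// subr_ge0.
  by rewrite ge_min lexx.
by rewrite ge_min lexx orbT.
Qed.

End maximal_coupling.

(** * Costs determined by the position of the first disagreement *)

Section first_disagreement.
Context (R : realType) (r : nat).
Implicit Types (v u : nat -> R) (x y : Omega r).

(** A common form for [dtheta], which is the case [v n = theta ^+ n.+1], and for the Lyapunov cost
    given by [V]. *)
Definition sepcost v x y : R :=
  if pselect (exists n : nat, x n != y n) is left xy then v (ex_minn xy) else 0.

Lemma sepcost_first v x y n : agree n x y -> x n != y n -> sepcost v x y = v n.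
Proof.
move=> xy xyn; rewrite /sepcost; case: pselect => [e|]; last by case; exists n.
congr v; case: ex_minnP => m xym min_m; apply/eqP; rewrite eqn_leq min_m//=.
by rewrite leqNgt; apply: contraNN xym => mn; apply/eqP/xy.
Qed.

Lemma sepcostxx v x : sepcost v x x = 0.
Proof.
rewrite /sepcost; case: pselect => // e; exfalso.
by case: e => n; rewrite eqxx.
Qed.

Lemma disagreement_cases x y :
  x = y \/ exists n, agree n x y /\ x n != y n.
Proof.
case: (pselect (exists n : nat, x n != y n)) => [e|ne]; last first.
  left; apply/funext => n; apply: contrapT => /eqP xyn; apply: ne; by exists n.
right; case: (ex_minnP e) => n xyn min_n; exists n; split => // i lt_in.
by apply/eqP; apply: contraTT lt_in => /min_n; rewrite -leqNgt.
Qed.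

Lemma sepcost_mono v u x y : (forall n, v n <= u n) ->
  sepcost v x y <= sepcost u x y.
Proof. by move=> vu; rewrite /sepcost; case: pselect. Qed.

Lemma sepcost_ge0 v x y : (forall n, 0 <= v n) -> 0 <= sepcost v x y.
Proof. by move=> v0; rewrite /sepcost; case: pselect. Qed.

Lemma sepcost_le1 v x y : (forall n, v n <= 1) -> sepcost v x y <= 1.
Proof. by move=> v1; rewrite /sepcost; case: pselect. Qed.

Lemma sepcostZ c v x y : sepcost (fun n => c * v n) x y = c * sepcost v x y.
Proof. by rewrite /sepcost; case: pselect => // _; rewrite mulr0. Qed.

Lemma agree_prepend n (b : 'I_r.+1) x y :
  agree n x y -> agree n.+1 (prepend b x) (prepend b y).
Proof. by move=> xy [|i] //=; rewrite ltnS => /xy. Qed.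

(** A common letter in front delays the first disagreement by one position. *)
Lemma sepcost_prepend v (b : 'I_r.+1) x y :
  sepcost v (prepend b x) (prepend b y) = sepcost (fun n => v n.+1) x y.
Proof.
have [->|[n [xy xyn]]] := disagreement_cases x y; first by rewrite !sepcostxx.
by rewrite (sepcost_first _ xy xyn) (sepcost_first _ (agree_prepend b xy)).
Qed.

Lemma measurable_agree n :
  measurable [set p : Omega r * Omega r | agree n p.1 p.2].
Proof.
have -> : [set p : Omega r * Omega r | agree n p.1 p.2] =
    \bigcap_(i < n) \bigcup_(b in [set: 'I_r.+1])
      ([set x : Omega r | x i = b] `*` [set y : Omega r | y i = b]).
  apply/seteqP; split=> p /=.
    by move=> pn i /= /pn pi; exists (p.1 i).
  by move=> pn i /= lt_in; have [b _ [/= -> ->]] := pn i lt_in.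
apply: bigcap_measurableType => i _.
apply: fin_bigcup_measurable => [|b _]; first exact: finite_finset.
by apply: measurableX; exact: measurable_coord.
Qed.

(** The cost takes countably many values: [v n] on [E n] minus [E n.+1], and 0 on the diagonal,
    which is the intersection [D] of all [E n]. *)
Lemma measurable_sepcost v :
  measurable_fun setT (fun p : Omega r * Omega r => sepcost v p.1 p.2).
Proof.
move=> _ B mB; rewrite setTI.
pose E n := [set p : Omega r * Omega r | agree n p.1 p.2].
pose D := \bigcap_n E n.
have mE n : measurable (E n) by exact: measurable_agree.
have mD : measurable D by exact: bigcapT_measurable.
have -> : (fun p : Omega r * Omega r => sepcost v p.1 p.2) @^-1` B =
    \bigcup_n (if v n \in B then E n `\` E n.+1 else set0) `|`
    (if 0 \in B then D else set0).
  apply/seteqP; split=> [[x y]|[x y] [[n _]|]] /=.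
  - have [<-|[n [xy xyn]]] := disagreement_cases x y.
      by rewrite sepcostxx => B0; right; rewrite mem_set.
    rewrite (sepcost_first _ xy xyn) => Bn; left; exists n => //.
    rewrite mem_set//; split => //= /(_ n (ltnSn n)) xyE.
    by move/eqP: xyn.
  - case: ifPn => // /set_mem Bn [/= xy nxy].
    rewrite (@sepcost_first _ _ _ n)//; apply: contra_notN nxy => /eqP xyn i.
    by rewrite ltnS leq_eqVlt => /predU1P[->|/xy].
  - case: ifPn => // /set_mem B0 xy.
    suff -> : x = y by rewrite sepcostxx.
    by apply/funext => n; exact: (xy n.+1 I n (ltnSn n)).
apply: measurableU; last by case: ifP.
apply: bigcup_measurable => n _; case: ifP => // _.
exact: measurableD.
Qed.

End first_disagreement.

(** * One step of the dual operator on couplings *)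

Section coupling_step.
Context (R : realType) (r : nat) (logJ : Omega r -> R).
Hypothesis cJ : continuous logJ.
Hypothesis J1 : forall x, ruelle logJ (fun=> 1) x = 1.

Let J (b : 'I_r.+1) (x : Omega r) : R := expR (logJ (prepend b x)).

Let J_ge0 b x : 0 <= J b x. Proof. exact: expR_ge0. Qed.

Let sumJ x : \sum_b J b x = 1. Proof. exact: sum_weight. Qed.

Let mJ b : measurable_fun setT (J b). Proof. exact: measurable_weight. Qed.

Let mJ1 b : measurable_fun setT (fun p : Omega r * Omega r => J b p.1).
Proof. exact: measurableT_comp (mJ b) measurable_fst. Qed.

Let mJ2 b : measurable_fun setT (fun p : Omega r * Omega r => J b p.2).
Proof. exact: measurableT_comp (mJ b) measurable_snd. Qed.

Let M (p : Omega r * Omega r) := overlap (J^~ p.1) (J^~ p.2).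

Let W (bc : 'I_r.+1 * 'I_r.+1) (p : Omega r * Omega r) :=
  max_coupling (J^~ p.1) (J^~ p.2) bc.

Let W_ge0 bc p : 0 <= W bc p. Proof. exact: max_coupling_ge0. Qed.

Let mmin b :
  measurable_fun setT (fun p : Omega r * Omega r => Num.min (J b p.1) (J b p.2)).
Proof. exact: measurable_minr. Qed.

Let mW bc : measurable_fun setT (W bc).
Proof.
apply: measurable_funD; first by case: eqP.
apply: measurable_funM; first by apply: measurable_funM; exact: measurable_funB.
have mM : measurable_fun setT (fun p => 1 - M p).
  by apply: measurable_funB => //; exact: measurable_sum.
(* On nonnegative reals, 0 included, the inverse is the power [-1], whose measurability is known. *)
rewrite (_ : (fun p => _) = (fun p => (1 - M p) `^ (-1))).
  exact: measurableT_comp (measurable_powR _) mM.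
by apply/funext => p; rewrite powR_inv1// subr_ge0 overlap_le1.
Qed.

Let prepend2 (bc : 'I_r.+1 * 'I_r.+1) (p : Omega r * Omega r) :=
  (prepend bc.1 p.1, prepend bc.2 p.2).

Let mprepend2 bc : measurable_fun setT (prepend2 bc).
Proof.
apply/measurable_fun_pairP; split.
  exact: measurableT_comp (@measurable_prepend _ _) measurable_fst.
exact: measurableT_comp (@measurable_prepend _ _) measurable_snd.
Qed.

(** Used with [proj] equal to [fst] and [snd]: it expresses the dual of a marginal as an integral
    against [G], to be compared pointwise with the marginal of the new coupling. *)
Let ruelle_dual_marginal (mu : probability (Omega r) R)
    (G : probability (Omega r * Omega r)%type R)
    (proj : Omega r * Omega r -> Omega r) :
  measurable_fun setT proj ->
  (forall A, measurable A -> pushforward G proj A = mu A) ->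
  forall A, measurable A ->
  (ruelle_dual logJ mu A =
   \int[G]_p \sum_b (J b (proj p) * \1_A (prepend b (proj p)))%:E)%E.
Proof.
move=> mproj Gmu A mA.
have mI : measurable_fun setT (fun x => (\1_A x)%:E : \bar R).
  exact/measurable_EFinP/measurable_indic.
have I0 x : (0 <= (\1_A x)%:E :> \bar R)%E by rewrite lee_fin.
rewrite -[A in LHS]setIT -integral_indic// (integral_ruelle_dual cJ J1 mu mI I0).
pose h x : \bar R := (\sum_b (J b x * \1_A (prepend b x))%:E)%E.
have mh : measurable_fun setT h.
  apply: emeasurable_sum => b; apply/measurable_EFinP.
  apply: measurable_funM => //.
  by apply: measurableT_comp; [exact: measurable_indic|exact: measurable_prepend].
transitivity (\int[mu]_x h x)%E.
  by apply: eq_integral => x _; apply: eq_bigr => b _; rewrite EFinM.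
pose mproj_ := isMeasurableFun.Build _ _ _ _ _ mproj.
pose proj_ : {mfun _ >-> _} := HB.pack proj mproj_.
transitivity (\int[pushforward G proj_]_x h x)%E.
  by apply: eq_measure_integral => B mB _; exact/esym/Gmu.
rewrite ge0_integral_pushforward// => x _; apply: sume_ge0 => b _.
by rewrite lee_fin mulr_ge0.
Qed.

(** The marginals of [G'] come from those of [max_coupling]. For the cost, the diagonal mass
    [M (x, y)] moves the first disagreement from [n] to [n.+1], and the remaining mass pays at most
    1; the hypothesis on [V] bounds this total pointwise. *)
Lemma coupling_step (V : nat -> R) (rho : R) (mu1 mu2 : probability (Omega r) R)
    (G : probability (Omega r * Omega r)%type R) :
  (forall n, 0 <= V n <= 1) -> 0 <= rho ->
  (forall n x y, agree n x y -> x n != y n ->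
    M (x, y) * V n.+1 + (1 - M (x, y)) <= rho * V n) ->
  couplings mu1 mu2 G ->
  exists2 G', couplings (ruelle_dual logJ mu1) (ruelle_dual logJ mu2) G' &
  (\int[G']_p (sepcost V p.1 p.2)%:E <=
   rho%:E * \int[G]_p (sepcost V p.1 p.2)%:E)%E.
Proof.
move=> V01 rho0 Vrho GC.
have V0 n : 0 <= V n by have /andP[] := V01 n.
have V1 n : V n <= 1 by have /andP[] := V01 n.
have W1 p : \sum_bc W bc p = 1 by exact: max_coupling_sum1.
have [G' G'E] := exists_mixture G mprepend2 mW W_ge0 W1.
exists G'.
  move=> A mA; split.
    have GB B : measurable B -> pushforward G fst B = mu1 B by case/GC.
    rewrite (ruelle_dual_marginal measurable_fst GB mA).
    have mf : measurable (@fst (Omega r) (Omega r) @^-1` A).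
      by rewrite -[X in measurable X]setTI; exact: measurable_fst.
    have mI : measurable_fun setT (fun p =>
        (\1_(@fst (Omega r) (Omega r) @^-1` A) p)%:E : \bar R).
      exact/measurable_EFinP/measurable_indic.
    rewrite /pushforward -[X in G' X]setIT -integral_indic// G'E//.
    apply: eq_integral => p _.
    under eq_bigr do rewrite -EFinM.
    rewrite !sumEFin; congr EFin.
    rewrite -(pair_bigA _ (fun b c => W (b, c) p * \1_A (prepend b p.1)))/=.
    by apply: eq_bigr => b _; rewrite -mulr_suml max_coupling_suml.
  have GB B : measurable B -> pushforward G snd B = mu2 B by case/GC.
  rewrite (ruelle_dual_marginal measurable_snd GB mA).
  have mf : measurable (@snd (Omega r) (Omega r) @^-1` A).
    by rewrite -[X in measurable X]setTI; exact: measurable_snd.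
  have mI : measurable_fun setT (fun p =>
      (\1_(@snd (Omega r) (Omega r) @^-1` A) p)%:E : \bar R).
    exact/measurable_EFinP/measurable_indic.
  rewrite /pushforward -[X in G' X]setIT -integral_indic// G'E//.
  apply: eq_integral => p _.
  under eq_bigr do rewrite -EFinM.
  rewrite !sumEFin; congr EFin.
  rewrite -(pair_bigA _ (fun b c => W (b, c) p * \1_A (prepend c p.2)))/=.
  rewrite exchange_big/=.
  by apply: eq_bigr => b _; rewrite -mulr_suml max_coupling_sumr.
have ms : measurable_fun setT
    (fun p : Omega r * Omega r => (sepcost V p.1 p.2)%:E).
  by apply/measurable_EFinP; exact: measurable_sepcost.
have s0 (p : Omega r * Omega r) : (0 <= (sepcost V p.1 p.2)%:E)%E.
  by rewrite lee_fin sepcost_ge0.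
rewrite G'E// -ge0_integralZl//; apply: ge0_le_integral => //.
- move=> p _; apply: sume_ge0 => bc _; apply: mule_ge0; rewrite lee_fin//.
  exact: sepcost_ge0.
- apply: emeasurable_sum => bc; apply: emeasurable_funM.
    exact/measurable_EFinP.
  exact: measurableT_comp ms (mprepend2 bc).
- exact: measurable_funeM.
move=> [x y] _ /=; under eq_bigr do rewrite -EFinM.
rewrite sumEFin -EFinM lee_fin.
have := @max_coupling_cost R _ (J^~ x) (J^~ y)
  (sumJ x) (sumJ y) (fun bc => sepcost V (prepend bc.1 x) (prepend bc.2 y)).
move=> /(_ (fun bc => sepcost_le1 _ _ V1)); move/le_trans; apply => /=.
under eq_bigr do rewrite sepcost_prepend.
rewrite -mulr_suml -/(overlap _ _).
(* On the diagonal both sides are 0, since a probability vector has overlap 1 with itself. *)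
have [xy|[n [xy xyn]]] := disagreement_cases x y.
  rewrite xy !sepcostxx !mulr0 add0r /overlap.
  by under eq_bigr do rewrite minxx; rewrite sumJ subrr.
by rewrite !(sepcost_first _ xy xyn); exact: Vrho.
Qed.

End coupling_step.

(** * Contraction *)

Lemma exists_expr_le (R : realType) (x e : R) : 0 <= x < 1 -> 0 < e ->
  exists n, x ^+ n.+1 <= e.
Proof.
move=> /andP[x0 x1] e0.
have /cvg_expr/cvgrPdist_lt/(_ e e0)[n _ ne] : `|x| < 1 by rewrite ger0_norm.
exists n; have := ne n.+1 (leqnSn n).
by rewrite /= sub0r normrN ger0_norm ?exprn_ge0// => /ltW.
Qed.

(* Below height [m] the deficit [1 - V n] grows geometrically, so that a gain
   with the uniform probability [expR (- K)] compensates a fall to level [0];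
   above it [V n] decays like [theta ^+ n], the order of the falling
   probability. *)
Lemma exists_lyapunov_profile (R : realType) (theta K : R) :
  0 < theta < 1 -> 1 <= K ->
  exists (V : nat -> R) (rho A : R), [/\ 0 <= rho < 1, 0 < A,
    (forall n, 0 <= V n <= 1),
    (forall n, 2^-1 * theta ^+ n <= V n <= A * theta ^+ n) &
    forall n s, expR (- (K * theta ^+ n)) <= s <= 1 ->
      s * V n.+1 + (1 - s) <= rho * V n].
Proof.
move=> /andP[th0 th1] K1.
have K0 : 0 < K by rewrite (lt_le_trans _ K1).
pose kappa := expR (- K).
have kappa0 : 0 < kappa by exact: expR_gt0.
have kappa1 : kappa <= 1 by rewrite -expR0 ler_expR oppr_le0 ltW.
(* As [kappa * beta = 2], the expected deficit after a step from [n < m] is at least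
   [2 * eps * beta ^+ n]; the surplus over the present deficit is at least [eps], which gives the
   rate [1 - eps]. *)
pose beta := 2 / kappa.
have kb : kappa * beta = 2 by rewrite mulrC divfK// gt_eqF.
have beta2 : 2 <= beta by rewrite ler_pdivlMr// ler_piMr.
have beta1 : 1 <= beta by rewrite (le_trans _ beta2)// ler1n.
have bn1 n : 1 <= beta ^+ n by exact: exprn_ege1.
(* The solution of [A * theta + K = (1 + theta) / 2 * A]: for [n >= m] a fall has probability at
   most [K * theta ^+ n] and costs at most 1. *)
pose A := 2 * K / (1 - theta).
have A2 : 2 <= A.
  rewrite ler_pdivlMr ?subr_gt0// ler_pM2l//.
  by rewrite (le_trans _ K1)// lerBlDr lerDl ltW.
have A0 : 0 < A by rewrite (lt_le_trans _ A2).
have tn0 n : 0 < theta ^+ n by rewrite exprn_gt0.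
have tn1 n : theta ^+ n <= 1 by rewrite exprn_ile1// ltW.
have [m Am] : exists m, A * theta ^+ m <= 2^-1.
  have [||m mA] := @exists_expr_le R theta (2^-1 / A); first by rewrite ltW.
    by rewrite divr_gt0// invr_gt0.
  by exists m.+1; rewrite mulrC -ler_pdivlMr.
(* Normalized so that [1 - eps * beta ^+ n] decreases to exactly [2^-1] at [n = m], where
   [A * theta ^+ n] is already at most [2^-1]. *)
pose eps := (beta ^+ m)^-1 / 2.
have eps0 : 0 < eps by rewrite divr_gt0// invr_gt0 (lt_le_trans _ (bn1 m)).
have epsm : eps * beta ^+ m = 2^-1.
  by rewrite /eps mulrAC mulVf ?mul1r// gt_eqF// (lt_le_trans _ (bn1 m)).
have epsb n : (n <= m)%N -> eps * beta ^+ n <= 2^-1.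
  by move=> nm; rewrite -epsm ler_pM2l// ler_weXn2l.
have eps_half : eps <= 2^-1 by have := epsb 0%N (leq0n m); rewrite expr0 mulr1.
pose V n := if (n < m)%N then 1 - eps * beta ^+ n else A * theta ^+ n.
(* The case [n = m] is included so that the step crossing from below [m] to [m] is estimated like
   those before it. *)
have V_le n : (n <= m)%N -> V n <= 1 - eps * beta ^+ n.
  rewrite /V; case: ltnP => // mn nm.
  have -> : n = m by apply/eqP; rewrite eqn_leq nm.
  by rewrite epsm; apply: le_trans Am _; lra.
have V_hi n : (m <= n)%N -> V n = A * theta ^+ n by rewrite /V ltnNge => ->.
have V_lo n : (n < m)%N -> V n = 1 - eps * beta ^+ n by rewrite /V => ->.
have hi_half n : (m <= n)%N -> A * theta ^+ n <= 2^-1.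
  by move=> mn; apply: le_trans Am; rewrite ler_pM2l// ler_wiXn2l// ltW.
have ebn0 n : 0 < eps * beta ^+ n.
  by rewrite mulr_gt0// (lt_le_trans _ (bn1 n)).
have V01 n : 0 <= V n <= 1.
  have [nm|mn] := ltnP n m.
    by rewrite V_lo//; have := epsb n (ltnW nm); have := ebn0 n; lra.
  rewrite V_hi//; have := hi_half n mn; have := mulr_gt0 A0 (tn0 n); lra.
(* One rate for each range of [n]; the added [(theta ^+ m)^-1] makes the upper bound on [V n] at
   least 1 when [n < m]. *)
exists V, (Num.max (1 - eps) ((1 + theta) / 2)), (A + (theta ^+ m)^-1).
split => //.
- rewrite le_max gt_max; apply/andP; split; first by apply/orP; left; lra.
  by apply/andP; split; lra.
- by rewrite addr_gt0// invr_gt0.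
- move=> n; have tmi : 0 < (theta ^+ m)^-1 by rewrite invr_gt0.
  have [nm|mn] := ltnP n m.
    apply/andP; split.
      rewrite V_lo//; have := epsb n (ltnW nm); have := tn1 n; lra.
    apply: (@le_trans _ _ 1); first by have /andP[] := V01 n.
    have : 1 <= (theta ^+ m)^-1 * theta ^+ n.
      by rewrite mulrC ler_pdivlMr// mul1r ler_wiXn2l ?(ltW th0) ?(ltW th1) ?(ltnW nm).
    by rewrite mulrDl; have := mulr_gt0 A0 (tn0 n); lra.
  rewrite V_hi// mulrDl; apply/andP; split.
    by rewrite ler_pM2r//; lra.
  by rewrite lerDl mulr_ge0 ?ltW.
- move=> n s /andP[ks s1].
  have tKn : K * theta ^+ n <= K by rewrite ler_piMr// ltW.
  have kappas : kappa <= s by apply: le_trans ks; rewrite ler_expR lerN2.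
  have Kns : 1 - K * theta ^+ n <= s.
    by apply: le_trans ks; exact: expR_ge1Dx.
  have s0 : 0 <= s by rewrite (le_trans (ltW kappa0)).
  have /andP[Vn0 Vn1] := V01 n.
  have [nm|mn] := ltnP n m.
    apply: (@le_trans _ _ ((1 - eps) * V n)); last first.
      by rewrite ler_wpM2r// le_max lexx.
    have := V_le n.+1 nm; rewrite exprS.
    rewrite (V_lo n nm); have := ebn0 n; have := bn1 n.
    set b := beta ^+ n => b1 eb VS.
    have h1 : s * V n.+1 <= s * (1 - eps * (beta * b)) by exact: ler_wpM2l.
    have h2 : kappa * beta * (eps * b) <= s * beta * (eps * b).
      by rewrite ler_pM2r// ler_pM2r// (lt_le_trans ltr01).
    rewrite kb in h2.
    have h3 : eps * 1 <= eps * b by rewrite ler_pM2l.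
    have h4 : 0 <= eps * (eps * b) by rewrite mulr_ge0// ltW.
    lra.
  apply: (@le_trans _ _ ((1 + theta) / 2 * V n)); last first.
    by rewrite ler_wpM2r// le_max lexx orbT.
  rewrite (V_hi n mn) (V_hi n.+1 (leqW mn)) exprS.
  have h1 : s * (A * (theta * theta ^+ n)) <= A * (theta * theta ^+ n).
    by apply: ler_piMl s1; apply/ltW/mulr_gt0 => //; exact: mulr_gt0.
  have h2 : A * (1 - theta) = 2 * K by rewrite divfK// subr_eq0 gt_eqF.
  have h3 : A * (1 - theta) * theta ^+ n = 2 * K * theta ^+ n by rewrite h2.
  lra.
Qed.

(** * Regularity of the potential and comparison of costs *)

Lemma dthetaE (R : realType) (r : nat) (theta : R) (x y : Omega r) :
  dtheta theta x y = theta * sepcost (fun n => theta ^+ n) x y.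
Proof. by rewrite /dtheta /sepcost; case: pselect => [e|_]; rewrite ?exprS ?mulr0. Qed.

Lemma dtheta_lipschitz_continuous (R : realType) (r : nat) (theta : R)
    (f : Omega r -> R) :
  0 < theta < 1 -> dtheta_lipschitz theta f -> continuous f.
Proof.
move=> /andP[th0 th1] [K fK]; apply/continuous_Omega => x e e0.
have K0 : 0 < `|K| + 1 by rewrite ltr_wpDl.
have [||m me] := @exists_expr_le R theta (e / (`|K| + 1)).
- by rewrite ltW.
- exact: divr_gt0.
exists m => y xy; have [<-|[n [xyn xyNn]]] := disagreement_cases x y.
  by rewrite subrr normr0.
have mn : (m <= n)%N.
  by rewrite leqNgt; apply: contraNN xyNn => nm; apply/eqP/xy.
have d0 : 0 < theta ^+ n.+1 by exact: exprn_gt0.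
apply: le_lt_trans (fK x y) _.
rewrite dthetaE (sepcost_first _ xyn xyNn) -exprS.
apply: le_lt_trans (_ : `|K| * theta ^+ n.+1 < _).
  by rewrite ler_pM2r// ler_norm.
apply: lt_le_trans (_ : (`|K| + 1) * theta ^+ n.+1 <= _).
  by rewrite ltr_pM2r// ltrDl.
rewrite mulrC -ler_pdivlMr//; apply: le_trans me.
by apply: ler_wiXn2l => //; exact: ltW.
Qed.

(** The Lipschitz bound on [logJ] makes each weight at [y] at least [expR (- k)] times the one at
    [x]; so is the minimum of the two, and the weights at [x] sum to 1. Taking [|K| + 1] ensures the
    bound [1 <= K] asked by [exists_lyapunov_profile]. *)
Lemma overlap_ge (R : realType) (r : nat) (theta : R) (logJ : Omega r -> R) :
  0 < theta < 1 -> dtheta_lipschitz theta logJ ->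
  (forall x, ruelle logJ (fun=> 1) x = 1) ->
  exists2 K, 1 <= K & forall n x y, agree n x y -> x n != y n ->
    expR (- (K * theta ^+ n)) <= overlap
      (fun b => expR (logJ (prepend b x))) (fun b => expR (logJ (prepend b y))).
Proof.
move=> /andP[th0 th1] [K JK] J1; exists (`|K| + 1); first by rewrite lerDr.
move=> n x y xy xyn; set k := (_ * _).
rewrite -[leLHS]mulr1 -(sum_weight J1 x) mulr_sumr; apply: ler_sum => b _.
have Jxy : `|logJ (prepend b x) - logJ (prepend b y)| <= k.
  apply: le_trans (JK _ _) _.
  rewrite dthetaE sepcost_prepend (sepcost_first _ xy xyn).
  have tn0 : 0 < theta ^+ n by exact: exprn_gt0.
  (* After prepending, the distance is [theta ^+ n.+2]; it is weakened to [theta ^+ n]. *)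
  have t1 : theta * theta ^+ n.+1 <= theta ^+ n.
    by rewrite -exprS; apply: ler_wiXn2l; [exact: ltW|exact: ltW|rewrite leqW].
  apply: le_trans (_ : `|K| * (theta * theta ^+ n.+1) <= _).
    by rewrite ler_wpM2r ?ler_norm// mulr_ge0// ?exprn_ge0// ltW.
  apply: le_trans (_ : `|K| * theta ^+ n <= _); first by rewrite ler_wpM2l.
  by rewrite ler_pM2r// lerDl.
rewrite -expRD le_min !ler_expR.
move: Jxy; rewrite ler_norml => /andP[h1 h2].
have : 0 <= k by rewrite mulr_ge0 ?exprn_ge0// ?addr_ge0// ltW.
by move=> k0; apply/andP; split; lra.
Qed.

Lemma iter_coupling (R : realType) (r : nat) (logJ : Omega r -> R)
    (V : nat -> R) (rho : R) (mu1 mu2 : probability (Omega r) R)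
    (G : probability (Omega r * Omega r)%type R) (t : nat) :
  continuous logJ -> (forall x, ruelle logJ (fun=> 1) x = 1) ->
  (forall n, 0 <= V n <= 1) -> 0 <= rho ->
  (forall n x y, agree n x y -> x n != y n ->
    let s := overlap (fun b => expR (logJ (prepend b x)))
      (fun b => expR (logJ (prepend b y))) in
    s * V n.+1 + (1 - s) <= rho * V n) ->
  couplings mu1 mu2 G ->
  exists2 Gt, couplings (iter t (ruelle_dual logJ) mu1)
                        (iter t (ruelle_dual logJ) mu2) Gt &
  (\int[Gt]_p (sepcost V p.1 p.2)%:E <=
   (rho ^+ t)%:E * \int[G]_p (sepcost V p.1 p.2)%:E)%E.
Proof.
move=> cJ J1 V01 rho0 Vrho GC; elim: t => [|t [Gt GtC Gtle]].
  by exists G => //; rewrite expr0 mul1e.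
have [G' G'C G'le] := coupling_step cJ J1 V01 rho0 Vrho GtC.
exists G' => //; apply: le_trans G'le _.
by rewrite exprS EFinM -muleA lee_wpmul2l// lee_fin.
Qed.

Lemma integral_coupling_le (R : realType) (r : nat)
    (G : probability (Omega r * Omega r)%type R)
    (f g : Omega r * Omega r -> R) (c : R) :
  measurable_fun setT f -> measurable_fun setT g ->
  (forall p, 0 <= f p) -> (forall p, 0 <= g p) -> 0 <= c ->
  (forall p, f p <= c * g p) ->
  (\int[G]_p (f p)%:E <= c%:E * \int[G]_p (g p)%:E)%E.
Proof.
move=> mf mg f0 g0 c0 fg.
have mgE : measurable_fun setT (EFin \o g) by exact/measurable_EFinP.
rewrite -ge0_integralZl//; last by move=> p _; rewrite lee_fin.
apply: ge0_le_integral => //.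
- by move=> p _; rewrite lee_fin.
- exact/measurable_EFinP.
- exact: measurable_funeM.
- by move=> p _; rewrite -EFinM lee_fin.
Qed.

(** In the second bound the factor [theta^-1] suffices where [Dmetric] is truncated to 1, because
    the cost is at most 1; elsewhere [theta^-1 * delta] undoes the rescaling. Their sum covers both
    cases. *)
Lemma Dmetric_sepcost (R : realType) (r : nat) (theta delta : R) :
  0 < theta < 1 -> 0 < delta -> forall x y : Omega r,
  Dmetric theta delta x y <= delta^-1 * sepcost (fun n => theta ^+ n) x y /\
  sepcost (fun n => theta ^+ n) x y <=
    theta^-1 * (1 + delta) * Dmetric theta delta x y.
Proof.
move=> /andP[th0 th1] d0 x y; rewrite /Dmetric dthetaE; set s := sepcost _ x y.
have s0 : 0 <= s by apply: sepcost_ge0 => n; rewrite exprn_ge0// ltW.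
have s1 : s <= 1 by apply: sepcost_le1 => n; rewrite exprn_ile1 ?ltW.
have ts : theta * s <= s by rewrite ler_piMl// ltW.
split.
  by rewrite ge_min; apply/orP; right; rewrite ler_pM2l// invr_gt0.
rewrite -mulrA ler_pdivlMl//; have [_|_] := leP 1 (delta^-1 * (theta * s)).
  by rewrite mulr1; apply: le_trans ts _; lra.
rewrite mulrDl mul1r [delta * _]mulrA mulfV ?gt_eqF// mul1r.
by rewrite lerDr mulr_ge0 ?invr_ge0 ?mulr_ge0// ltW.
Qed.

Lemma measurable_Dmetric (R : realType) (r : nat) (theta delta : R) :
  measurable_fun setT (fun p : Omega r * Omega r => Dmetric theta delta p.1 p.2).
Proof.
apply: measurable_minr => //; apply: measurable_funM => //.
rewrite (_ : (fun p => _) = (fun p : Omega r * Omega r =>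
  theta * sepcost (fun n => theta ^+ n) p.1 p.2)).
  by apply: measurable_funM => //; exact: measurable_sepcost.
by apply/funext => p; rewrite dthetaE.
Qed.

Unset Implicit Arguments.
Set Strict Implicit.

Theorem theorem5 (R : realType) (r : nat) (theta : R)
  (theta01 : 0 < theta < 1)
  (logJ : Omega r -> R)
  (logJ_lip : dtheta_lipschitz theta logJ)
  (logJ_normalized : forall x, ruelle logJ (fun=> 1) x = 1)
  (C alpha1 : R) (C_gt0 : 0 < C) (alpha1_01 : 0 < alpha1 < 1)
  (lasota_yorke : forall t : nat, (0 < t)%N ->
    forall phi : Omega r -> R, dtheta_lipschitz theta phi ->
      (theta_seminorm theta (iter t (ruelle logJ) phi)
       <= C%:E * sup_abs phi + alpha1%:E * theta_seminorm theta phi)%E)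
  (delta : R) (delta_bounds : 0 < delta < (1 - alpha1) / (2 * C))
  (a : R) (a_gt0 : 0 < a)
  (a_coupling : exists T : nat, forall k : nat, (T <= k)%N ->
    forall x y : Omega r,
      (a%:E <= ereal_sup
        [set G [set p : Omega r * Omega r |
                 (dtheta theta p.1 p.2 <= delta / 2)%R] |
         G in couplings (iter k (ruelle_dual logJ) (dirac_prob R x))
                        (iter k (ruelle_dual logJ) (dirac_prob R y))])%E) :
  let alpha := Num.max (1 - a / 2) (1 / 2 * (1 + alpha1)) in
  let d1 := wasserstein1 (Dmetric theta delta) in
  alpha < 1 /\
  exists t : nat, (0 < t)%N /\
    forall mu1 mu2 : probability (Omega r) R,
      (d1 (iter t (ruelle_dual logJ) mu1) (iter t (ruelle_dual logJ) mu2)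
       <= alpha%:E * d1 mu1 mu2)%E.
Proof.
move=> alpha d1.
have /andP[al0 al1] := alpha1_01.
(* Since [alpha1] is positive, a contraction by 1/2 is enough. *)
have alpha_half : 1 / 2 <= alpha by rewrite le_max; apply/orP; right; lra.
have delta0 : 0 < delta by have /andP[] := delta_bounds.
have th0 : 0 < theta by have /andP[] := theta01.
split; first by rewrite gt_max; apply/andP; split; lra.
have cJ := dtheta_lipschitz_continuous theta01 logJ_lip.
have [K K1 overlapK] := overlap_ge theta01 logJ_lip logJ_normalized.
have [V [rho [A [rho01 A0 V01 Vtheta Vrho]]]] := exists_lyapunov_profile theta01 K1.
have V0 n : 0 <= V n by have /andP[] := V01 n.
pose c1 := delta^-1 * 2; pose c2 := A * (theta^-1 * (1 + delta)).
have c10 : 0 < c1 by rewrite mulr_gt0// invr_gt0.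
have c20 : 0 < c2 by rewrite mulr_gt0// mulr_gt0 ?invr_gt0// addr_gt0.
have DV (p : Omega r * Omega r) :
    Dmetric theta delta p.1 p.2 <= c1 * sepcost V p.1 p.2.
  apply: le_trans (Dmetric_sepcost theta01 delta0 p.1 p.2).1 _.
  rewrite -mulrA ler_pM2l ?invr_gt0// -sepcostZ; apply: sepcost_mono => n.
  by have /andP[] := Vtheta n; lra.
have VD (p : Omega r * Omega r) :
    sepcost V p.1 p.2 <= c2 * Dmetric theta delta p.1 p.2.
  rewrite -mulrA; apply: le_trans (_ : A * sepcost (fun n => theta ^+ n) p.1 p.2 <= _).
    by rewrite -sepcostZ; apply: sepcost_mono => n; have /andP[] := Vtheta n.
  by rewrite ler_pM2l//; exact: (Dmetric_sepcost theta01 delta0 p.1 p.2).2.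
(* The threshold absorbs the loss [c1 * c2] of passing from [Dmetric] to the cost [V] and back,
   leaving the factor 1/2. *)
have [t rhot] : exists t, rho ^+ t.+1 <= 1 / 2 / (c1 * c2).
  by apply: exists_expr_le => //; apply: divr_gt0; [lra|exact: mulr_gt0].
have /andP[rho0 _] := rho01.
exists t.+1; split => // mu1 mu2.
(* With [alpha] inside the infimum, it remains to improve on an arbitrary coupling [G] of [mu1] and
   [mu2]. *)
rewrite /d1 /wasserstein1 -ereal_inf_pZl; last by lra.
apply: le_ereal_inf_tmp => _ [_ [G GC <-] <-].
have stepV n x y : agree n x y -> x n != y n ->
    let s := overlap (fun b => expR (logJ (prepend b x)))
      (fun b => expR (logJ (prepend b y))) in
    s * V n.+1 + (1 - s) <= rho * V n.
  move=> xy xyn; apply: Vrho; rewrite overlapK//=.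
  by apply: overlap_le1; exact: sum_weight.
have [Gt GtC Gtle] := iter_coupling t.+1 cJ logJ_normalized V01 rho0 stepV GC.
apply: ge_ereal_inf; exists (\int[Gt]_p (Dmetric theta delta p.1 p.2)%:E)%E.
  by exists Gt.
have D0 (p : Omega r * Omega r) : 0 <= Dmetric theta delta p.1 p.2.
  rewrite -(pmulr_rge0 _ c20); apply: le_trans (VD p).
  exact: sepcost_ge0.
have sV0 (p : Omega r * Omega r) : 0 <= sepcost V p.1 p.2 by exact: sepcost_ge0.
have intD : (0 <= \int[G]_p (Dmetric theta delta p.1 p.2)%:E)%E.
  by apply: integral_ge0 => p _; rewrite lee_fin.
have mD := @measurable_Dmetric R r theta delta.
have mV := @measurable_sepcost R r V.
(* The chain runs from the [Dmetric] cost of [Gt] to its [V] cost, then to the [V] cost of [G], then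
   to the [Dmetric] cost of [G], with factors [c1], [rho ^+ t.+1] and [c2]. *)
apply: le_trans (integral_coupling_le Gt mD mV D0 sV0 (ltW c10) DV) _.
apply: (@le_trans _ _ (c1%:E * ((rho ^+ t.+1)%:E *
    (c2%:E * \int[G]_p (Dmetric theta delta p.1 p.2)%:E)))%E).
  apply: lee_wpmul2l; first by rewrite lee_fin ltW.
  apply: le_trans Gtle _; apply: lee_wpmul2l; first by rewrite lee_fin exprn_ge0.
  exact: (integral_coupling_le G mV mD sV0 D0 (ltW c20) VD).
rewrite !muleA -!EFinM; apply: lee_wpmul2r => //; rewrite lee_fin.
apply: le_trans alpha_half.
move: rhot; rewrite ler_pdivlMr; last exact: mulr_gt0 c10 c20.
by rewrite mulrCA mulrA.
Qed.
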